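(* Let $n\geq 2$ and let $k$ and $a_2,\dots,a_n$ be natural numbers (positive integers). If $$\gcd(2k,a_2k,a_3k,\dots,a_{n-1}k,a_n)=1$$ and $c$ is the smallest odd number among $a_2,a_3,\dots,a_n$, then $$g(2k,a_2k,\dots,a_{n-1}k,a_n)=k(c-2)+a_n(k-1).$$ In particular, $$g(2k,ak,b)=k(c-2)+b(k-1),$$ where $k,a,b$ are natural numbers with $\gcd(2k,ak,b)=1$, and where $c=b$ if $a$ is even, and $c=\min(a,b)$ otherwise.
   Context: For positive integers $a_1,\dots,a_n$ with greatest common divisor $1$, the Frobenius number $g(a_1,\dots,a_n)$ is the greatest integer $b$ such that the equation $\sum_{i=1}^{n}a_ix_i=b$ has no solution in non-negative integers $x_1,\dots,x_n$.
   Formalization: In the ''in particular'' clause, for a odd and b even we take c=a instead of c=min(a,b); the printed formula fails when b<a (e.g. k=1, a=3, b=2: g(2,3,2)=1, but c=2 gives 0). All other cases are as stated. *)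

(* Defs.v *)
From mathcomp Require Import all_boot all_order all_algebra.
Set Implicit Arguments.
Unset Strict Implicit.
Unset Printing Implicit Defensive.

(* A tuple a_1, ..., a_n of natural numbers is the sequence
   s = [:: a_1; ...; a_n]; its gcd is \big[gcdn/0]_(x <- s) x. *)
Definition gcd_seq (s : seq nat) : nat := \big[gcdn/0]_(x <- s) x.

Definition representable (s : seq nat) (b : int) : Prop :=
  exists x : 'I_(size s) -> nat,
    Posz (\sum_(i < size s) nth 0 s i * x i) = b.

(* "g(s) = b".  The greatest element is taken over all integers, so that
   g(s) = -1 when 1 occurs in s. *)
Definition is_frobenius (s : seq nat) (b : int) : Prop :=
  ~ representable s b /\
  forall b' : int, ~ representable s b' -> (b' <= b)%R.

(* 2k, a_2 k, ..., a_{n-1} k, a_n.  The function a is only used at the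
   indices 2, ..., n; for n = 2 the sequence is 2k, a_2. *)
Definition generators (n k : nat) (a : nat -> nat) : seq nat :=
  (2 * k) :: rcons [seq a i * k | i <- index_iota 2 n] (a n).

Definition is_smallest_odd (s : seq nat) (c : nat) : Prop :=
  [/\ c \in s, odd c & forall d, d \in s -> odd d -> c <= d].

(* Main.v *)
Require Import Defs.
From mathcomp Require Import all_boot all_order all_algebra zify.
Set Implicit Arguments.
Unset Strict Implicit.
Unset Printing Implicit Defensive.

(** Write [b] for the last generator and [t] for the list of the other [a_i],
    so that the generators are [2k], the [a k] with [a] in [t], and [b].  Every
    generator but [b] is a multiple of [k], and [k] is coprime to [b], so the
    coefficient [y] of [b] in a combination is determined modulo [k] by the
    value of that combination.  A shift of [y] by [k] amounts to the
    generator [b k], and therefore, after division by [k], everything reduces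
    to the semigroup generated by [2], [t] and [b].

    In that semigroup the even numbers are multiples of [2] and the odd members
    are exactly the odd numbers [>= c]: an odd combination uses an odd
    generator ([odd_combination_ge]), and conversely one adds twos to [c].
    Its Frobenius number is thus [c - 2].

    Back to the original generators, the worst residue is that of
    [b (k - 1)].  If [k (c - 2) + b (k - 1)] were a combination, [y] would be
    congruent to [-1] modulo [k], hence [y = k - 1 + q k], and [c - 2] would lie
    in the smaller semigroup.  If [z > k (c - 2) + b (k - 1)], take [0 <= y < k]
    with [b y] congruent to [z] modulo [k] ([coprime_residue]); then
    [z - b y = k m] with [m > c - 2], so [m] lies in the smaller semigroup. *)

(** Coefficients indexed by all natural numbers rather than by an ordinal
    type that depends on the list allow the list to be split at either end. *)
Lemma representableE (s : seq nat) (z : int) :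
  representable s z <->
  exists f : nat -> nat, Posz (\sum_(0 <= i < size s) nth 0 s i * f i) = z.
Proof.
split=> [[x <-]|[f <-]]; last by exists (fun i => f i); rewrite big_mkord.
exists (fun i => if insub i is Some j then x j else 0).
by rewrite big_mkord; congr Posz; apply: eq_bigr => i _; rewrite valK.
Qed.

Lemma representable_scaledE (k b : nat) (t : seq nat) (z : int) :
  representable (2 * k :: rcons [seq x * k | x <- t] b) z <->
  exists u f y,
    Posz (k * (2 * u + \sum_(0 <= i < size t) nth 0 t i * f i) + b * y) = z.
Proof.
have splitE (f : nat -> nat) :
    let s := 2 * k :: rcons [seq x * k | x <- t] b in
    \sum_(0 <= i < size s) nth 0 s i * f i =
    k * (2 * f 0 + \sum_(0 <= i < size t) nth 0 t i * f i.+1)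
      + b * f (size t).+1.
  rewrite /= size_rcons size_map big_nat_recl //= big_nat_recr //=.
  rewrite nth_rcons size_map ltnn eqxx addnA mulnDr mulnA (mulnC k 2).
  congr (_ + _ + _); rewrite big_distrr; apply: eq_big_nat => i /andP[_ ltit] /=.
  by rewrite nth_rcons size_map ltit (nth_map 0) // mulnA (mulnC k).
rewrite representableE; split=> [[f <-]|[u [f [y <-]]]].
  by exists (f 0), (fun i => f i.+1), (f (size t).+1); rewrite splitE.
exists (fun i => if i is j.+1 then if j < size t then f j else y else u).
rewrite splitE /= ltnn; congr (Posz (_ * (_ + _) + _)).
by apply: eq_big_nat => i /andP[_ ->].
Qed.

Lemma mem_combination (t : seq nat) (x : nat) : x \in t ->
  exists f : nat -> nat, \sum_(0 <= i < size t) nth 0 t i * f i = x.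
Proof.
move=> xt; exists (fun i => nat_of_bool (i == index x t)).
have ltxt : index x t < size t by rewrite index_mem.
rewrite big_mkord (bigD1 (Ordinal ltxt)) //= eqxx nth_index // muln1.
rewrite big1 ?addn0 // => i; rewrite -val_eqE /= => /negPf->.
by rewrite muln0.
Qed.

(** An odd sum has an odd term, and an odd term [nth 0 t i * f i] forces both
    an odd generator and a nonzero coefficient. *)
Lemma odd_combination_mem (t : seq nat) (f : nat -> nat) :
  odd (\sum_(0 <= i < size t) nth 0 t i * f i) ->
  exists2 d, d \in t &
    odd d /\ d <= \sum_(0 <= i < size t) nth 0 t i * f i.
Proof.
rewrite big_mkord => odd_sum.
have [i odd_i|no_odd] := pickP (fun i : 'I_(size t) => odd (nth 0 t i * f i)).
  exists (nth 0 t i); first exact: mem_nth.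
  move: (odd_i); rewrite oddM => /andP[odd_d odd_f]; split=> //.
  rewrite (bigD1 i) //=; apply: leq_trans (leq_addr _ _).
  by rewrite leq_pmulr // odd_gt0.
move: odd_sum; suff -> : odd (\sum_(i < size t) nth 0 t i * f i) = false by [].
by apply: (big_ind (fun m => odd m = false)) => // m p; rewrite oddD => -> ->.
Qed.

Lemma odd_combination_ge (t : seq nat) (b c u q : nat) (f : nat -> nat) :
  is_smallest_odd (rcons t b) c ->
  let m := 2 * u + \sum_(0 <= i < size t) nth 0 t i * f i + b * q in
  odd m -> c <= m.
Proof.
case=> _ _ c_min /=; set S := bigop _ _ _.
have [odd_S _|even_S] := boolP (odd S).
  have [d dt [odd_d le_dS]] := odd_combination_mem odd_S.
  have := c_min d; rewrite mem_rcons inE dt orbT => /(_ isT odd_d).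
  by rewrite -/S in le_dS; lia.
rewrite 2!oddD !oddM (negPf even_S) /= => /andP[odd_b odd_q].
have := c_min b; rewrite mem_rcons inE eqxx => /(_ isT odd_b) le_cb.
by apply: leq_trans (leq_addl _ _); rewrite (leq_trans le_cb) ?leq_pmulr ?odd_gt0.
Qed.

Lemma coprime_residue (k b : nat) (z : int) : 0 < k -> coprime k b ->
  exists y : nat, exists m : int, y < k /\ (z = b%:Z * y%:Z + k%:Z * m)%R.
Proof.
move=> k_gt0 co_kb.
have [u [v uv1]] := Bezoutz k b.
rewrite /gcdz /= (eqP co_kb) in uv1.
have k_neq0 : (k%:Z != 0)%R by lia.
(* [v] inverts [b] modulo [k], so [y] is the residue of [v * z]. *)
have r_ge0 := modz_ge0 (v * z)%R k_neq0.
have r_lt : (modz (v * z) k%:Z < k%:Z)%R by apply: ltz_pmod; lia.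
have vzE := divz_eq (v * z)%R k.
case: (modz _ _) r_ge0 r_lt vzE => // y _ lt_yk vzE.
exists y, (u * z + b%:Z * divz (v * z) k%:Z)%R; split; first by lia.
have -> : (b%:Z * y%:Z = b%:Z * (v * z - divz (v * z) k%:Z * k%:Z))%R.
  by congr (_ * _)%R; lia.
by move: (divz _ _) => w; rewrite -[LHS]GRing.mul1r -[1%R]uv1; lia.
Qed.

Lemma frobenius_not_representable (k b c : nat) (t : seq nat) :
  0 < k -> coprime k b -> is_smallest_odd (rcons t b) c ->
  ~ representable (2 * k :: rcons [seq x * k | x <- t] b)
      (k%:Z * (c%:Z - 2) + b%:Z * (k%:Z - 1))%R.
Proof.
move=> k_gt0 co_kb c_min /representable_scaledE[u [f [y zE]]].
have := odd_combination_ge (u := u) (f := f) c_min.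
move: zE; set S := bigop _ _ _ => zE geS.
(* Subtraction-free form, valid also when [c = 1]. *)
have natE : k * (2 * u + S + 2) + b * y.+1 = k * (c + b) by lia.
have k_dvd : k %| y.+1.
  have : k %| k * (2 * u + S + 2) + b * y.+1 by rewrite natE dvdn_mulr.
  by rewrite (dvdn_addr _ (dvdn_mulr _ (dvdnn k))) Gauss_dvdr.
have [[|q] yE] := dvdnP k_dvd; first by [].
have smallE : 2 * u + S + b * q + 2 = c.
  suff : k * (2 * u + S + b * q + 2 + b) = k * (c + b).
    by move/eqP; rewrite eqn_pmul2l // eqn_add2r => /eqP.
  by rewrite -natE yE; lia.
case: c_min => _ odd_c _.
by have := geS q; rewrite -smallE oddD addbF in odd_c *; move=> /(_ odd_c); lia.
Qed.

Lemma representable_above_frobenius (k b c : nat) (t : seq nat) (z : int) :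
  0 < k -> coprime k b -> is_smallest_odd (rcons t b) c ->
  (k%:Z * (c%:Z - 2) + b%:Z * (k%:Z - 1) < z)%R ->
  representable (2 * k :: rcons [seq x * k | x <- t] b) z.
Proof.
move=> k_gt0 co_kb [c_in odd_c _] lt_z.
have [y [m [lt_yk zE]]] := coprime_residue z k_gt0 co_kb.
have lt_m : (c%:Z - 2 < m)%R.
  have le_by : b * y + b <= b * k by rewrite -mulnSr leq_mul2l lt_yk orbT.
  have k_gt0' : (0 < k%:Z)%R by lia.
  by rewrite -(Num.Theory.ltr_pM2l k_gt0'); lia.
have c_gt0 := odd_gt0 odd_c.
case: m => [m|m] in zE lt_m *; last by lia.
have zero_sum : \sum_(0 <= i < size t) nth 0 t i * 0 = 0.
  by apply: big1 => i _; rewrite muln0.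
apply/representable_scaledE.
have [odd_m|even_m] := boolP (odd m); last first.
  exists m./2, (fun=> 0), y; rewrite zero_sum addn0 mul2n even_halfK //.
  by lia.
have le_cm : c <= m.
  rewrite leqNgt; apply/negP => lt_mc.
  have mE : c = m.+1 by lia.
  by move: odd_c; rewrite mE /= odd_m.
have halfE : 2 * (m - c)./2 = m - c.
  by rewrite mul2n even_halfK // oddB // odd_m odd_c.
move: c_in; rewrite mem_rcons inE => /orP[/eqP cb|/mem_combination[f fE]].
  (* The odd generator is [b] itself: [k] further copies of it give [k c]. *)
  exists (m - c)./2, (fun=> 0), (y + k); rewrite zero_sum halfE zE -cb.
  rewrite addn0 mulnDr (mulnC c k) addnCA -mulnDr subnK //; lia.
by exists (m - c)./2, f, y; rewrite fE halfE subnK // zE; lia.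
Qed.

Lemma scaled_frobenius (k b c : nat) (t : seq nat) :
  0 < k -> coprime k b -> is_smallest_odd (rcons t b) c ->
  is_frobenius (2 * k :: rcons [seq x * k | x <- t] b)
    (k%:Z * (c%:Z - 2) + b%:Z * (k%:Z - 1))%R.
Proof.
move=> k_gt0 co_kb c_min; split; first exact: frobenius_not_representable.
move=> z nrep; rewrite Order.TotalTheory.leNgt; apply/negP => lt_z; apply: nrep.
exact: (representable_above_frobenius k_gt0 co_kb c_min).
Qed.

Lemma dvdn_gcd_seq (d : nat) (s : seq nat) :
  (forall x, x \in s -> d %| x) -> d %| gcd_seq s.
Proof.
move=> d_dvd; rewrite /gcd_seq big_seq.
apply: (big_ind (fun m => d %| m)) => // m p dm dp.
by rewrite dvdn_gcd dm dp.
Qed.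

Lemma coprime_of_gcd_seq (k b : nat) (t : seq nat) :
  gcd_seq (2 * k :: rcons [seq x * k | x <- t] b) = 1 -> coprime k b.
Proof.
move=> gcd1; rewrite /coprime -dvdn1 -[X in _ %| X]gcd1; apply: dvdn_gcd_seq => x.
rewrite inE mem_rcons inE => /or3P[/eqP->|/eqP->|/mapP[y _ ->]].
- exact: dvdn_mull (dvdn_gcdl _ _).
- exact: dvdn_gcdr.
- exact: dvdn_mull (dvdn_gcdl _ _).
Qed.

(** When [a] is even, [b] has to be odd, since otherwise [2] would divide all
    three generators. *)
Lemma smallest_odd_pair (k a b : nat) :
  gcd_seq [:: 2 * k; a * k; b] = 1 ->
  is_smallest_odd [:: a; b]
    (if ~~ odd a then b else if odd b then minn a b else a).
Proof.
move=> gcd1.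
have odd_ab : odd a || odd b.
  apply/norP => -[even_a even_b].
  suff : 2 %| 1 by [].
  rewrite -[X in _ %| X]gcd1; apply: dvdn_gcd_seq => x; rewrite !inE.
  by case/or3P=> /eqP->; rewrite dvdn2 ?oddM ?(negPf even_a).
case odd_a: (odd a) odd_ab => /= odd_b; last first.
  split=> // [|d]; rewrite !inE ?eqxx ?orbT // => /orP[]/eqP-> //.
  by rewrite odd_a.
case: ifP => {}odd_b; split=> //.
- by rewrite !inE; case: leqP; rewrite eqxx ?orbT.
- by case: leqP.
- by move=> d; rewrite !inE => /orP[]/eqP-> _; lia.
- by rewrite inE eqxx.
- by move=> d; rewrite !inE => /orP[]/eqP->; rewrite ?odd_b.
Qed.

Theorem proposition2p11 :
  (forall (n k : nat) (a : nat -> nat) (c : nat),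
     2 <= n -> 0 < k -> (forall i, 2 <= i <= n -> 0 < a i) ->
     gcd_seq (generators n k a) = 1 ->
     is_smallest_odd [seq a i | i <- index_iota 2 n.+1] c ->
     is_frobenius (generators n k a)
       (k%:Z * (c%:Z - 2) + (a n)%:Z * (k%:Z - 1))%R)
  /\
  (forall k a b : nat,
     0 < k -> 0 < a -> 0 < b ->
     gcd_seq [:: 2 * k; a * k; b] = 1 ->
     let c := if ~~ odd a then b
              else if odd b then minn a b
              else a in
     is_frobenius [:: 2 * k; a * k; b]
       (k%:Z * (c%:Z - 2) + b%:Z * (k%:Z - 1))%R).
Proof.
split=> [n k a c n_ge2 k_gt0 _ gcd1 c_min | k a b k_gt0 _ _ gcd1 c]; last first.
  apply: (@scaled_frobenius k b c [:: a]) => //.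
    exact: (@coprime_of_gcd_seq k b [:: a]).
  exact: smallest_odd_pair gcd1.
have genE : generators n k a =
    2 * k :: rcons [seq x * k | x <- [seq a i | i <- index_iota 2 n]] (a n).
  by rewrite /generators -map_comp.
rewrite genE in gcd1 *; apply: scaled_frobenius => //.
  exact: coprime_of_gcd_seq gcd1.
rewrite -map_rcons; suff -> : rcons (index_iota 2 n) n = index_iota 2 n.+1 by [].
by rewrite /index_iota subSn // -[(n - 2).+1]addn1 iotaD subnKC // cats1.
Qed.
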